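(* For each integer $m\geq 2$ there exists a function $\varphi_P\in MW_m$ that is strictly increasing but is not of the form $\phi_\mu$ for any $\mu\in\mathcal M_{(0,1)}$, where $\phi_\mu(x)=\int_{(0,1)}\varphi_p(x)\,d\mu(p)$ for $x\in[0,1]$ and $\varphi_p$ ($p\in(0,1)$) are the de Rham functions.
   Context: For $p\in(0,1)$ the de Rham function $\varphi_p\colon[0,1]\to\mathbb R$ is the unique bounded function satisfying $\varphi_p(\frac{x}{2})=p\varphi_p(x)$ and $\varphi_p(\frac{x+1}{2})=(1-p)\varphi_p(x)+p$ for all $x\in[0,1]$. $\mathcal M_{(0,1)}$ is the family of all Borel probability measures $\mu$ on $[0,1]$ with $\mu(\{0,1\})=0$. For $m\in\mathbb N$ (with $\mathbb N=\{1,2,\ldots\}$), $\mathcal P_m$ is the set of all tuples $P=(p_0,\ldots,p_{2^m-1})$ with $p_0,\ldots,p_{2^m-1}\in[0,1)$ and $\sum_{k=0}^{2^m-1}p_k=1$. Put $K=\{0,1,\ldots,2^m-1\}$ and $f_k\colon[0,1]\to[0,1]$, $f_k(x)=\frac{x+k}{2^m}$ for $k\in K$. For $P\in\mathcal P_m$, $\mu_P$ denotes the unique (by a theorem of Hutchinson) Borel probability measure on $[0,1]$ satisfying $\mu_P(B)=\sum_{k\in K}p_k\,\mu_P(f_k^{-1}(B))$ for every Borel set $B\subset[0,1]$, and $\Phi_P(x)=\mu_P([0,x])$ for $x\in[0,1]$. For $m\ge 2$ and $P\in\mathcal P_m$, the function $\varphi_P\colon[0,1]\to[0,1]$ is defined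 by $$\varphi_P(x)=\frac{1}{m}\sum_{i=0}^{m-1}\sum_{k=0}^{2^i-1}\left[\Phi_P\left(\frac{x+k}{2^i}\right)-\Phi_P\left(\frac{k}{2^i}\right)\right],$$ and $MW_m=\{\varphi_P\mid P\in\mathcal P_m\}$. *)

(* Defs.v *)
From HB Require Import structures.
From mathcomp Require Import all_boot all_order all_algebra.
From mathcomp Require Import all_classical all_reals all_analysis.

Set Implicit Arguments.
Unset Strict Implicit.
Unset Printing Implicit Defensive.
Import Order.TTheory GRing.Theory Num.Theory.
Import numFieldNormedType.Exports.
Local Open Scope classical_set_scope.
Local Open Scope ring_scope.

(* Functions on [0, 1] are rendered as total functions R -> R whose values
   outside [0, 1] carry no information; Borel probability measures on [0, 1]
   are rendered as Borel probability measures mu on R with mu [0, 1] = 1. *)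

Definition is_deRham (R : realType) (p : R) (phi : R -> R) : Prop :=
  [/\ [bounded phi x | x in `[0, 1]],
      forall x, x \in `[0, 1] -> phi (x / 2) = p * phi x &
      forall x, x \in `[0, 1] -> phi ((x + 1) / 2) = (1 - p) * phi x + p].

(* For 0 < p < 1 the conditions is_deRham p determine the values on [0, 1]
   uniquely, so the choice made by get is irrelevant there. *)
Definition deRham (R : realType) (p : R) : R -> R := get (is_deRham p).

Definition unit_probability (R : realType)
    (mu : probability (measurableTypeR R) R) : Prop :=
  mu `[0%R, 1%R]%classic = 1%E.

Definition M01 (R : realType) : set (probability (measurableTypeR R) R) :=
  [set mu | unit_probability mu /\ mu [set 0%R; 1%R] = 0%E].

Arguments M01 R : clear implicits.

Definition deRham_mixture (R : realType)
    (mu : probability (measurableTypeR R) R) (x : R) : R :=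
  \int[mu]_(p in `]0%R, 1%R[%classic) deRham p x.

Definition weights (R : realType) (m : nat) : set ('I_(2 ^ m) -> R) :=
  [set P | (forall k, 0 <= P k < 1) /\ \sum_(k < 2 ^ m) P k = 1].

Arguments weights R m : clear implicits.

Definition ifs_map (R : realType) (m : nat) (k : 'I_(2 ^ m)) (x : R) : R :=
  (x + k%:R) / 2 ^+ m.

(* ifs_map k is a map on [0, 1]: hence the intersection with [0, 1] in the
   preimage. *)
Definition self_similar (R : realType) (m : nat) (P : 'I_(2 ^ m) -> R)
    (mu : probability (measurableTypeR R) R) : Prop :=
  unit_probability mu /\
  forall B : set (measurableTypeR R), measurable B -> B `<=` `[0%R, 1%R]%classic ->
    mu B = (\sum_(k < 2 ^ m)
              (P k)%:E * mu (`[0%R, 1%R]%classic `&` ifs_map k @^-1` B))%E.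

(* By Hutchinson's theorem self_similar P has exactly one element when P is in
   weights R m; the default value \d_0 is only used outside this case. *)
Definition hutchinson (R : realType) (m : nat) (P : 'I_(2 ^ m) -> R) :
    probability (measurableTypeR R) R :=
  xget (\d_(0 : measurableTypeR R) : probability (measurableTypeR R) R)
    (self_similar P).

Definition Phi (R : realType) (m : nat) (P : 'I_(2 ^ m) -> R) (x : R) : R :=
  fine (hutchinson P `[0%R, x]%classic).

Definition varphi (R : realType) (m : nat) (P : 'I_(2 ^ m) -> R) (x : R) : R :=
  m%:R^-1 * \sum_(i < m) \sum_(k < 2 ^ i)
    (Phi P ((x + k%:R) / 2 ^+ i) - Phi P (k%:R / 2 ^+ i)).

Definition MW (R : realType) (m : nat) : set (R -> R) :=
  [set varphi P | P in weights R m].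
Arguments MW R m : clear implicits.

(* Main.v *)
(* The self-similar measure of weights P has as distribution function the limit
   of the decreasing sequence T^n 1_[0, oo[, with
   T F x = \sum_k P_k F (2 ^ m x - k): T preserves right-continuity and
   monotonicity, and T 1_[0, oo[ <= 1_[0, oo[.  Here m = 1 also gives the
   existence of the de Rham functions.

   Since phi_p (1/2) = p and phi_p (1/4) = p ^ 2, a de Rham mixture phi satisfies
   phi (1/4) - phi (1/2) + 1/4 = \int (p - 1/2) ^ 2 >= 0.  Moving a quarter of
   the uniform mass of k to k + 1 for each k = 0 mod 4 makes the block "00" at the
   end of a word of binary digits rarer; all weights stay positive, so varphi is
   strictly increasing, but the quantity above becomes - 1 / (32 m). *)
Require Import Defs.
From HB Require Import structures.
From mathcomp Require Import all_boot all_order all_algebra.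
From mathcomp Require Import all_classical all_reals all_analysis.
From mathcomp Require Import measurable_realfun zify ring lra.
Import Order.TTheory GRing.Theory Num.Theory.
Import numFieldNormedType.Exports.
Local Open Scope classical_set_scope.
Local Open Scope ring_scope.

Set Implicit Arguments.
Unset Strict Implicit.
Unset Printing Implicit Defensive.

(** * The self-similar distribution function as the limit of iterated transfer *)

Section self_similar_cdf.
Context (R : realType) (m : nat) (P : 'I_(2 ^ m) -> R).
Hypothesis wP : weights R m P.

Let P_ge0 k : 0 <= P k. Proof. by case: wP => /(_ k)/andP[]. Qed.
Let sumP : \sum_k P k = 1. Proof. by case: wP. Qed.
Let N_gt0 : 0 < 2 ^+ m :> R. Proof. exact: exprn_gt0. Qed.

(** If [F] is the distribution function of a measure, this is the one of the [P]-weighted sum of its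
    images under the maps [ifs_map k], since [ifs_map k t <= x] means [t <= x * 2 ^+ m - k%:R]. *)
Definition transfer (F : R -> R) (x : R) : R :=
  \sum_k P k * F (x * 2 ^+ m - k%:R).

Definition transfer_iter n : R -> R := iter n transfer (fun x : R => (0 <= x)%R%:R).

Lemma transfer_le F G : (forall x, F x <= G x) ->
  forall x, transfer F x <= transfer G x.
Proof. by move=> FG x; apply: ler_sum => k _; exact: ler_wpM2l. Qed.

Lemma transfer_homo F : {homo F : x y / x <= y} ->
  {homo transfer F : x y / x <= y}.
Proof.
move=> Fh x y xy; apply: ler_sum => k _; apply: ler_wpM2l => //; apply: Fh.
by rewrite lerD2r ler_pM2r.
Qed.

Lemma transfer_lt0 F : (forall x, x < 0 -> F x = 0) ->
  forall x, x < 0 -> transfer F x = 0.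
Proof.
move=> F0 x x0; apply: big1 => k _; rewrite F0 ?mulr0//.
by rewrite subr_lt0 (lt_le_trans _ (ler0n R k))// pmulr_llt0.
Qed.

Lemma transfer_ge1 F : (forall x, 1 <= x -> F x = 1) ->
  forall x, 1 <= x -> transfer F x = 1.
Proof.
move=> F1 x x1; rewrite -[RHS]sumP; apply: eq_bigr => k _; rewrite F1 ?mulr1//.
have : (k.+1%:R : R) <= 2 ^+ m by rewrite -natrX ler_nat.
rewrite -natr1 lerBrDr addrC => /le_trans; apply.
by rewrite ler_peMl// ltW.
Qed.

Lemma cvg_at_right_affine (a b x : R) : 0 < a ->
  (y * a + b) @[y --> x^'+] --> (x * a + b)^'+.
Proof.
move=> a0 A [/= e e0 eA]; exists (e / a) => /=; first by rewrite divr_gt0.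
move=> y /= xy xlty; apply: eA => /=; last by rewrite ltrD2r ltr_pM2r.
have -> : x * a + b - (y * a + b) = (x - y) * a by ring.
by rewrite normrM (gtr0_norm a0) -ltr_pdivlMr.
Qed.

Lemma transfer_right_continuous (F : R -> R) : right_continuous F ->
  right_continuous (transfer F).
Proof.
move=> Frc x; rewrite /transfer; apply: cvg_big => [|k _]; first exact: add_continuous.
apply: cvgMl_tmp; apply: (cvg_comp _ _ _ (Frc _)).
exact: cvg_at_right_affine.
Qed.

Lemma transfer_iter_homo n : {homo transfer_iter n : x y / x <= y}.
Proof.
elim: n => [x y xy|n IH]; last exact: transfer_homo.
rewrite /transfer_iter/= ler_nat; case: (leP 0 x) => //= x0.
by rewrite (le_trans x0 xy).
Qed.

Lemma transfer_iter_lt0 n x : x < 0 -> transfer_iter n x = 0.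
Proof.
elim: n x => [x x0|n IH]; last exact: transfer_lt0.
by rewrite /transfer_iter/= leNgt x0.
Qed.

Lemma transfer_iter_ge1 n x : 1 <= x -> transfer_iter n x = 1.
Proof.
elim: n x => [x x1|n IH]; last exact: transfer_ge1.
by rewrite /transfer_iter/= (le_trans ler01 x1).
Qed.

Lemma transfer_iter_ge0 n x : 0 <= transfer_iter n x.
Proof.
have [x0|x0] := ltP x 0; first by rewrite transfer_iter_lt0.
rewrite (le_trans _ (transfer_iter_homo n (_ : - 1 <= x)))//.
  by rewrite transfer_iter_lt0// oppr_lt0.
by rewrite (le_trans _ x0)// oppr_le0.
Qed.

Lemma transfer_iter_le1 n x : transfer_iter n x <= 1.
Proof.
have [x1|x1] := leP 1 x; first by rewrite transfer_iter_ge1.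
by rewrite -(transfer_iter_ge1 n (lexx 1)); apply/transfer_iter_homo/ltW.
Qed.

(** The first iterate vanishes left of 0 and is at most 1 elsewhere, so it lies below the initial
    step function; monotonicity of [transfer] propagates this. *)
Lemma transfer_iterS_le n x : transfer_iter n.+1 x <= transfer_iter n x.
Proof.
elim: n x => [x|n IH x]; last exact: transfer_le.
have [x0|x0] := ltP x 0; first by rewrite !transfer_iter_lt0.
by rewrite [leRHS](_ : _ = 1) ?transfer_iter_le1// /transfer_iter/= x0.
Qed.

Lemma transfer_iter_right_continuous n : right_continuous (transfer_iter n).
Proof.
elim: n => [x|n IH]; last exact: transfer_right_continuous.
apply: cvg_near_cst; have [x0|x0] := leP 0 x; near=> y.
  by rewrite /transfer_iter/= x0 (le_trans x0)//; exact: nbhs_right_ge.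
by rewrite !transfer_iter_lt0.
Unshelve. all: by end_near. Qed.

Definition self_similar_cdf (x : R) : R := inf (range (transfer_iter ^~ x)).
Local Notation F := self_similar_cdf.

Let cvg_cdf x : transfer_iter n x @[n --> \oo] --> F x.
Proof.
apply: nonincreasing_cvgn.
  by apply/nonincreasing_seqP => n; exact: transfer_iterS_le.
by exists 0 => _ [n _ <-]; exact: transfer_iter_ge0.
Qed.

Let cdf_le_iter n x : F x <= transfer_iter n x.
Proof.
apply: ge_inf; last by exists n.
by exists 0 => _ [k _ <-]; exact: transfer_iter_ge0.
Qed.

Lemma self_similar_cdf_fixed x : transfer F x = F x.
Proof.
have cF : [sequence transfer_iter n.+1 x]_n @ \oo --> F x.
  by rewrite (cvg_shiftS (transfer_iter ^~ x)); exact: cvg_cdf.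
apply/esym/(cvg_unique _ cF) => //.
by apply: cvg_big => [|k _]; first exact: add_continuous; apply: cvgMl_tmp; exact: cvg_cdf.
Qed.

Lemma self_similar_cdf_homo : {homo F : x y / x <= y}.
Proof.
move=> x y xy; apply: (ler_cvg_to (@cvg_cdf x) (@cvg_cdf y)).
by apply: nearW => n; exact: transfer_iter_homo.
Qed.

Lemma self_similar_cdf_lt0 x : x < 0 -> F x = 0.
Proof.
move=> x0; apply: (cvg_unique _ (@cvg_cdf x)) => //; apply: cvg_near_cst.
by apply: nearW => n; exact: transfer_iter_lt0.
Qed.

Lemma self_similar_cdf_ge1 x : 1 <= x -> F x = 1.
Proof.
move=> x0; apply: (cvg_unique _ (@cvg_cdf x)) => //; apply: cvg_near_cst.
by apply: nearW => n; exact: transfer_iter_ge1.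
Qed.

(** At 0 every branch except the first evaluates [F] at a negative point, so [F 0 = P_0 * F 0] with
    [P_0 < 1]. *)
Lemma self_similar_cdf0 : F 0 = 0.
Proof.
have N0 : (0 < 2 ^ m)%N by rewrite expn_gt0.
case: wP => /(_ (Ordinal N0))/andP[_ P1] _.
have := self_similar_cdf_fixed 0.
rewrite /transfer (bigD1 (Ordinal N0))//= mul0r subr0 big1.
  by rewrite addr0 => /eqP; rewrite -subr_eq0 -{2}(mul1r (F 0)) -mulrBl mulf_eq0
    subr_eq0 lt_eqF//= => /eqP.
move=> k k0; rewrite self_similar_cdf_lt0 ?mulr0// sub0r oppr_lt0 ltr0n.
by rewrite lt0n; apply: contraNneq k0 => k0; apply/eqP/val_inj.
Qed.

(** An infimum of nondecreasing right-continuous functions: for [y] slightly right of [x], [F y]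
    lies between [F x] and an iterate at [y], which is close to the same iterate at [x], itself
    close to [F x]. *)
Lemma self_similar_cdf_right_continuous : right_continuous F.
Proof.
move=> x; apply/cvgrPdist_le => e e0.
have [n Fn] : exists n, transfer_iter n x <= F x + e / 2.
  have /cvgrPdist_le/(_ (e / 2)) := @cvg_cdf x.
  rewrite divr_gt0// => /(_ erefl)[n _ /(_ n (leqnn n))].
  by rewrite /= ler_distl => /andP[? ?]; exists n; lra.
have /cvgrPdist_le/(_ (e / 2)) := @transfer_iter_right_continuous n x.
rewrite divr_gt0// => /(_ erefl) H; near=> y.
have : `|transfer_iter n x - transfer_iter n y| <= e / 2 by near: y.
have xy : F x <= F y by apply: self_similar_cdf_homo; near: y; exact: nbhs_right_ge.
have Fy := cdf_le_iter n y.
rewrite !ler_distl => /andP[? ?]; apply/andP; split; lra.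
Unshelve. all: by end_near. Qed.

End self_similar_cdf.

(** * Existence of the self-similar measure *)

Section self_similar_measure.
Context (R : realType) (m : nat) (P : 'I_(2 ^ m) -> R).
Hypothesis wP : weights R m P.

Let P_ge0 k : 0 <= P k.
Proof. by case: wP => [+ _] => /(_ k)/andP[]. Qed.
Let N_gt0 : 0 < 2 ^+ m :> R. Proof. exact: exprn_gt0. Qed.

Let F := self_similar_cdf P.

Let F_homo : {homo F : x y / x <= y}. Proof. exact: self_similar_cdf_homo. Qed.
Let F_rc : right_continuous F. Proof. exact: self_similar_cdf_right_continuous. Qed.

Let F_Ny : F @ -oo --> (0 : R).
Proof.
apply: cvg_near_cst; near=> x; apply: self_similar_cdf_lt0 => //.
Unshelve. all: by end_near. Qed.

Let F_y : F @ +oo --> (1 : R).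
Proof.
apply: cvg_near_cst; near=> x; apply: self_similar_cdf_ge1 => //.
Unshelve. all: by end_near. Qed.

Let cF : cumulativeBounded 0 1 :=
  HB.pack F (isCumulative.Build R _ R F F_homo F_rc)
    (isCumulativeBounded.Build R 0 1 F F_Ny F_y).

Let nu : probability (measurableTypeR R) R := lebesgue_stieltjes_measure cF.

Let nu_itv a b : a <= b -> nu `]a, b]%classic = (F b - F a)%:E.
Proof.
move=> ab; rewrite /nu/= /lebesgue_stieltjes_measure /measure_extension.
by rewrite measurable_mu_extE/= ?wlength_itv_bnd//; exact: is_ocitv.
Qed.

Let nu01 : nu `[0, 1]%classic = 1%E.
Proof.
apply/eqP; rewrite eq_le probability_le1//=.
have <- : nu `]0, 1]%classic = 1%E.
  rewrite nu_itv// /F self_similar_cdf_ge1// self_similar_cdf0// subr0 //.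
by apply: le_measure; rewrite ?inE//; exact: subset_itv_oc_cc.
Qed.

(** [msum] takes a family indexed by [nat], so the weights are extended by 0 beyond [2 ^ m]. *)
Let weight (k : nat) : {nonneg R} :=
  if insub k is Some i then NngNum (P_ge0 i) else 0%:nng.

Let branch (k : nat) (x : measurableTypeR R) : measurableTypeR R :=
  (x + k%:R) / 2 ^+ m.

Let mbranch k : measurable_fun setT (branch k).
Proof. by apply: measurable_funM => //; exact: measurable_funD. Qed.

Let mf_branch k : {mfun measurableTypeR R >-> measurableTypeR R} :=
  HB.pack (branch k) (isMeasurableFun.Build _ _ _ _ (branch k) (mbranch k)).

Let transported : {measure set (measurableTypeR R) -> \bar R} :=
  msum (fun k => mscale (weight k) (distribution nu (mf_branch k))) (2 ^ m).

Let transportedE A : transported A =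
  (\sum_(k < 2 ^ m) (P k)%:E * nu (ifs_map k @^-1` A))%E.
Proof.
apply: eq_bigr => k _; rewrite /mscale /weight/=.
by case: insubP => [i _ /val_inj ->//|]; rewrite ltn_ord.
Qed.

(** A Lebesgue-Stieltjes measure is determined by its values on half-open intervals, and there the
    claim is the fixed-point equation of [F]. *)
Let nu_transported A : measurable A -> nu A = transported A.
Proof.
apply: lebesgue_stieltjes_measure_unique => _ [[a b] _ <-] /=.
have [ab|ba] := leP a b; last by rewrite set_itv_ge ?measure0// bnd_simp -leNgt ltW.
rewrite -/(nu _) nu_itv//.
rewrite transportedE /F -!(self_similar_cdf_fixed wP) /transfer -sumrB -sumEFin.
apply: eq_bigr => k _; rewrite -mulrBr EFinM; congr (_ * _)%E.
rewrite (_ : _ @^-1` _ =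
    `]a * 2 ^+ m - k%:R, b * 2 ^+ m - k%:R]%classic) ?nu_itv//.
  by rewrite lerD2r ler_pM2r.
apply/seteqP; split=> x; rewrite /ifs_map /= !in_itv/= ltrBlDr lerBrDr;
  by rewrite ltr_pdivlMr// ler_pdivrMr.
Qed.

Lemma self_similar_exists :
  exists mu : probability (measurableTypeR R) R, self_similar P mu.
Proof.
exists nu; split=> // B mB _; rewrite nu_transported// transportedE.
apply: eq_bigr => k _; congr (_ * _)%E.
have mA : measurable (ifs_map k @^-1` B : set (measurableTypeR R)).
  by rewrite -[_ @^-1` _]setTI; exact: (@mbranch k).
(* The preimage is cut along [[0, 1]]; the part outside is null because [nu] gives [[0, 1]] mass
   1. *)
rewrite -[in LHS](setIT (_ @^-1` _)) -(setUv `[0, 1]) setIUr measureU//; last 3 first.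
- exact: measurableI.
- by apply: measurableI => //; exact: measurableC.
- by rewrite setIACA setICr setI0.
rewrite setIC -[RHS]adde0; congr (_ + _)%E; apply/eqP.
have mAC : measurable (ifs_map k @^-1` B `&` ~` `[0, 1] : set (measurableTypeR R)).
  by apply: measurableI => //; exact: measurableC.
rewrite -measure_le0// -(subee (_ : 1%E \is a fin_num))//.
rewrite -[X in (_ - X)%E]nu01 -probability_setC//.
by apply: le_measure; rewrite ?inE//; exact: measurableC.
Qed.
End self_similar_measure.

(** * Functional equations of [Phi] *)

Section hutchinson_cdf.
Context (R : realType) (m : nat) (P : 'I_(2 ^ m) -> R).
Hypothesis wP : weights R m P.

Let mu : probability (measurableTypeR R) R := hutchinson P.

Let mu_self_similar : self_similar P mu.
Proof. exact: (xgetPex _ (self_similar_exists wP)). Qed.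

Let mu01 : mu `[0, 1]%classic = 1%E.
Proof. by case: mu_self_similar. Qed.

Let muE B : measurable (B : set (measurableTypeR R)) ->
  B `<=` `[0, 1]%classic ->
  mu B = (\sum_(k < 2 ^ m) (P k)%:E * mu (`[0%R, 1%R]%classic `&` ifs_map k @^-1` B))%E.
Proof. by case: mu_self_similar => _; apply. Qed.

Let N_gt0 : 0 < 2 ^+ m :> R. Proof. exact: exprn_gt0. Qed.

Let PhiE x : (Phi P x)%:E = mu `[0, x]%classic.
Proof. by rewrite /Phi fineK// fin_num_measure. Qed.

Lemma Phi_homo : {homo Phi P : x y / x <= y}.
Proof.
move=> x y xy; rewrite -lee_fin !PhiE.
by apply: le_measure; rewrite ?inE//; exact: subset_itvl.
Qed.

Lemma Phi1 : Phi P 1 = 1.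
Proof. by apply/EFin_inj; rewrite PhiE. Qed.

(** [hutchinson P] is a chosen measure known only through [self_similar], so the absence of an atom
    at 0 is derived again: within [[0, 1]] only the first branch reaches 0, and only from 0, whence
    [Phi P 0 = P_0 * Phi P 0]. *)
Lemma Phi0 : Phi P 0 = 0.
Proof.
have N0 : (0 < 2 ^ m)%N by rewrite expn_gt0.
case: wP => /(_ (Ordinal N0))/andP[_ P1] _.
have : (Phi P 0)%:E = ((P (Ordinal N0)) * Phi P 0)%:E.
  rewrite PhiE muE//; last by move=> x /=; rewrite !in_itv/= => /andP[-> /le_trans->].
  rewrite (bigD1 (Ordinal N0))//= big1 => [|j j0].
    rewrite EFinM PhiE adde0; congr (_ * mu _)%E.
    apply/seteqP; split=> x; rewrite /ifs_map/= addr0 !in_itv/=.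
      by rewrite ler_pdivrMr// ler_pdivlMr// !mul0r => -[].
    move=> /andP[x0 x0']; have -> : x = 0 by apply/eqP; rewrite eq_le x0 x0'.
    by rewrite mul0r lexx ler01.
  rewrite (_ : _ `&` _ = set0) ?measure0 ?mule0//.
  apply/seteqP; split=> // x []; rewrite /ifs_map/= !in_itv/= => /andP[x0 _].
  rewrite ler_pdivrMr// mul0r => /andP[_]; rewrite leNgt => /negP; apply.
  rewrite ltr_wpDl// ltr0n lt0n; apply: contraNneq j0 => j0.
  exact/eqP/val_inj.
move=> /eqP; rewrite eqe -subr_eq0 -{1}(mul1r (Phi P 0)) -mulrBl mulf_eq0.
by rewrite subr_eq0 gt_eqF//= => /eqP.
Qed.

(** Within [[0, 1]], the preimage of the interval under branch [j] is all of [[0, 1]] for [j < k],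
    is [[0, x]] for [j = k], and is null for [j > k]. *)
Lemma Phi_ifs_map (k : 'I_(2 ^ m)) x : 0 <= x <= 1 ->
  Phi P ((x + k%:R) / 2 ^+ m) = \sum_(j < 2 ^ m | (j < k)%N) P j + P k * Phi P x.
Proof.
move=> /andP[x0 x1]; apply/EFin_inj; rewrite PhiE muE//; last first.
  move=> y /=; rewrite !in_itv/= => /andP[-> /le_trans]; apply.
  rewrite ler_pdivrMr// mul1r (le_trans (_ : _ <= 1 + k%:R))// ?lerD2r//.
  by rewrite addrC natr1 -natrX ler_nat.
rewrite (bigD1 k)//= addeC EFinD EFinM PhiE; congr (_ + _ * mu _)%E; last first.
  apply/seteqP; split=> y; rewrite /ifs_map/= !in_itv/= ler_pM2r ?invr_gt0// lerD2r.
    by move=> -[/andP[-> _] /andP[_ ->]].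
  move=> /andP[y0 yx]; rewrite y0 (le_trans yx x1) yx; split=> //.
  by rewrite divr_ge0 ?addr_ge0// ltW.
rewrite big_mkcond/= -sumEFin [RHS]big_mkcond/=; apply: eq_bigr => j _.
have [jk|jk|/val_inj ->] := ltngtP j k; last by rewrite eqxx.
- have -> : j != k by rewrite -(inj_eq val_inj) (ltn_eqF jk).
  rewrite (_ : _ `&` _ = `[0, 1]%classic) ?mu01 ?mule1//.
  apply/seteqP; split=> y; rewrite /ifs_map/= !in_itv/= ler_pM2r ?invr_gt0//.
    by case.
  move=> /andP[y0 y1]; split; first by rewrite y0 y1.
  rewrite divr_ge0 ?addr_ge0//=.
  rewrite (le_trans (_ : _ <= 1 + j%:R)) ?lerD2r//.
  by rewrite nat1r (le_trans (_ : _ <= k%:R)) ?ler_nat// lerDr.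
(* This preimage need not be empty: for [x = 1] and [j = k + 1] it is the common endpoint 0, which
   [Phi0] shows to be null. *)
- have -> : j != k by rewrite -(inj_eq val_inj) (gtn_eqF jk).
  rewrite (_ : mu _ = 0%E) ?mule0//; apply/eqP.
  have mu0 : mu `[0, 0]%classic = 0%E by rewrite -PhiE Phi0.
  rewrite -measure_le0 -[leRHS]mu0.
  have mB : measurable (`[0, 1]%classic `&`
      ifs_map j @^-1` `[0, (x + k%:R) / 2 ^+ m] : set (measurableTypeR R)).
    apply: measurableI => //; rewrite -[X in measurable X]setTI.
    have : measurable_fun setT (ifs_map j : measurableTypeR R -> measurableTypeR R).
      by apply: measurable_funM => //; exact: measurable_funD.
    by apply.
  apply: le_measure; rewrite ?inE// => y; rewrite /ifs_map/= !in_itv/=.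
  rewrite ler_pM2r ?invr_gt0// => -[/andP[-> _] /andP[_ yx]] /=.
  rewrite -(lerD2r j%:R) (le_trans yx)// add0r (le_trans (_ : _ <= 1 + k%:R)) ?lerD2r//.
  by rewrite addrC natr1 ler_nat.
Qed.

End hutchinson_cdf.

(** * De Rham functions at 1/2 and 1/4, and the variance inequality for mixtures *)

Section deRham_values.
Context (R : realType).

(** Take [Phi] for two branches of weights [p] and [1 - p]; [Phi_ifs_map] for the digits 0 and 1
    gives the two equations. *)
Lemma is_deRham_exists (p : R) : 0 < p < 1 -> exists phi, is_deRham p phi.
Proof.
move=> /andP[p0 p1].
pose P (k : 'I_(2 ^ 1)) := if val k == 0%N then p else 1 - p.
have wP : weights R 1 P.
  split; last by rewrite big_ord_recl big_ord1 /P/= addrC subrK.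
  by move=> k; rewrite /P; case: ifP => _; apply/andP; split; lra.
have lt21 : (1 < 2 ^ 1)%N by [].
have lt20 : (0 < 2 ^ 1)%N by [].
exists (Phi P); split.
- exists 1; split; first exact: num_real.
  move=> M M1 x /=; rewrite in_itv/= => /andP[x0 x1].
  have := @Phi_homo _ _ P _ _ x0; have := @Phi_homo _ _ P _ _ x1.
  by rewrite (Phi0 wP) (Phi1 wP) => ? ?; rewrite (le_trans _ (ltW M1))// ger0_norm.
- move=> x; rewrite in_itv/= => x01.
  have := Phi_ifs_map wP (Ordinal lt20) x01.
  by rewrite /= addr0 expr1 => ->; rewrite big_pred0 ?add0r// => j; rewrite ltn0.
- move=> x; rewrite in_itv/= => x01.
  have := Phi_ifs_map wP (Ordinal lt21) x01.
  rewrite /= expr1 => ->; rewrite addrC big_mkcond big_ord_recl big_ord1/=.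
  by rewrite addr0.
Qed.

Lemma deRhamP (p : R) : 0 < p < 1 -> is_deRham p (deRham p).
Proof. by move=> /is_deRham_exists; exact: getPex. Qed.

Lemma deRham_half (p : R) : 0 < p < 1 -> deRham p (1 / 2) = p.
Proof.
move=> p01; have [_ lo hi] := deRhamP p01; case/andP: p01 => p0 p1.
have i1 : (1 : R) \in `[0, 1] by rewrite in_itv/= ler01 lexx.
(* The point 1 is fixed by the upper branch, which forces the value 1 there; the lower equation then
   gives the value at 1/2. *)
have := hi 1 i1; rewrite (lo 1 i1) (_ : (1 + 1) / 2 = 1 :> R); last by field.
move=> h; have /eqP : p * (deRham p 1 - 1) = 0 by lra.
by rewrite mulf_eq0 gt_eqF//= subr_eq0 => /eqP ->; rewrite mulr1.
Qed.

Lemma deRham_quarter (p : R) : 0 < p < 1 -> deRham p (1 / 4) = p * p.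
Proof.
move=> p01; have [_ lo hi] := deRhamP p01.
rewrite (_ : 1 / 4 = (1 / 2) / 2); last by field.
by rewrite lo ?deRham_half// in_itv/=; lra.
Qed.

Lemma deRham_mixture_variance (mu : probability (measurableTypeR R) R) :
  0 <= deRham_mixture mu (1 / 4) - deRham_mixture mu (1 / 2) + 1 / 4.
Proof.
have mD : measurable (`]0%R, 1%R[%classic : set (measurableTypeR R)) by [].
have -> : deRham_mixture mu (1 / 4) = \int[mu]_(p in `]0%R, 1%R[%classic) (p * p).
  by apply: eq_Rintegral => p; rewrite inE/= in_itv/= => /deRham_quarter.
have -> : deRham_mixture mu (1 / 2) = \int[mu]_(p in `]0%R, 1%R[%classic) p.
  by apply: eq_Rintegral => p; rewrite inE/= in_itv/= => /deRham_half.
have integrable_bnd (f : measurableTypeR R -> R) : measurable_fun setT f ->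
    (forall p, 0 < p < 1 -> `|f p| <= 1) -> mu.-integrable `]0%R, 1%R[%classic (EFin \o f).
  move=> mf f1; apply: measurable_bounded_integrable => //.
  - by rewrite (le_lt_trans (probability_le1 _ _))// ltry.
  - exact: measurable_funTS.
  - exists 1; split; first exact: num_real.
    move=> M M1 x /=; rewrite in_itv/= => x01.
    exact: le_trans (f1 _ x01) (ltW M1).
have int1 : mu.-integrable `]0%R, 1%R[%classic (EFin \o (fun p : R => p)).
  apply: integrable_bnd => // p /andP[p0 p1]; rewrite ger0_norm; lra.
have int2 : mu.-integrable `]0%R, 1%R[%classic (EFin \o (fun p : R => p * p)).
  apply: integrable_bnd => [|p /andP[p0 p1]]; first exact: measurable_funM.
  by rewrite ger0_norm ?mulr_ge0 ?mulr_ile1// ltW.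
have intc : mu.-integrable `]0%R, 1%R[%classic (EFin \o (fun p : R => 1 / 4)).
  by apply: integrable_bnd => // p _; rewrite ger0_norm; lra.
have : 0 <= \int[mu]_(p in `]0%R, 1%R[%classic) (p * p - p + 1 / 4).
  apply: Rintegral_ge0 => p _.
  by rewrite (_ : _ + _ = (p - 1 / 2) ^+ 2) ?sqr_ge0//; field.
rewrite RintegralD//; last first.
  apply: integrable_bnd => [|p /andP[p0 p1]]; last by rewrite ler_norml; nra.
  by apply: measurable_funB => //; exact: measurable_funM.
rewrite RintegralB// => /le_trans; apply; rewrite lerD2l.
(* The constant integrates to a quarter of the mass of []0, 1[], at most 1/4. *)
rewrite Rintegral_cst// ler_piMr//.
by rewrite -lee_fin fineK ?probability_le1// fin_num_measure.
Qed.

End deRham_values.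

(** * Strict monotonicity for positive weights *)

Section strict_monotonicity.
Context (R : realType) (m : nat) (P : 'I_(2 ^ m) -> R).
Hypotheses (wP : weights R m P) (P_gt0 : forall k, 0 < P k).

Let N_gt0 n : 0 < (2 ^+ m) ^+ n :> R.
Proof. by rewrite !exprn_gt0. Qed.

Let NE n : (((2 ^ m) ^ n)%N)%:R = (2 ^+ m) ^+ n :> R.
Proof. by rewrite !natrX. Qed.

(** Induction on the number of digits in base [2 ^ m]: stripping the leading digit [k] by
    [Phi_ifs_map] scales the increment by [P k > 0], down to [Phi P 0 < Phi P 1]. *)
Lemma Phi_adic_lt n j : (j < (2 ^ m) ^ n)%N ->
  Phi P (j%:R / (2 ^+ m) ^+ n) < Phi P (j.+1%:R / (2 ^+ m) ^+ n).
Proof.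
elim: n j => [j|n IH j jN].
  by rewrite expn0 ltnS leqn0 => /eqP ->; rewrite expr0 !divr1 Phi0// Phi1.
have Nn0 : (0 < (2 ^ m) ^ n)%N by rewrite !expn_gt0.
have kN : (j %/ (2 ^ m) ^ n < 2 ^ m)%N by rewrite ltn_divLR// -expnS.
pose k := Ordinal kN; pose i := (j %% (2 ^ m) ^ n)%N.
have iN : (i < (2 ^ m) ^ n)%N by rewrite ltn_mod.
have split_digit l : ((l + k * (2 ^ m) ^ n)%N)%:R / (2 ^+ m) ^+ n.+1 =
    (l%:R / (2 ^+ m) ^+ n + k%:R) / 2 ^+ m :> R.
  rewrite natrD natrM NE exprSr; field.
  by rewrite !lt0r_neq0// -(expr1 (2 ^+ m)).
have bnd l : (l <= (2 ^ m) ^ n)%N -> 0 <= l%:R / (2 ^+ m) ^+ n <= (1 : R).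
  by move=> lN; rewrite divr_ge0//= ler_pdivrMr// mul1r -NE ler_nat.
have -> : j = (i + k * (2 ^ m) ^ n)%N by rewrite addnC -divn_eq.
rewrite -addSn !split_digit !Phi_ifs_map ?bnd//; last exact: ltnW.
by rewrite ltrD2l ltr_pM2l// IH.
Qed.

Lemma Phi_lt : (0 < m)%N -> {in `[0, 1] &, {homo Phi P : x y / x < y}}.
Proof.
move=> m0 x y; rewrite !in_itv/= => /andP[x0 x1] /andP[y0 y1] xy.
(* The factor 2 makes room for a whole adic interval between [x] and [y], from index [t + 1] to
   [t + 2], where [t] is the integer part of the rescaled [x]. *)
have [n nxy] : exists n, 2 / (y - x) < (2 ^+ m) ^+ n :> R.
  exists (Num.truncn (2 / (y - x))).+1; set t := Num.truncn _.
  apply: (lt_trans (truncnS_gt _)); rewrite -NE ltr_nat.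
  by rewrite (leq_trans (ltn_expl _ (_ : 1 < 2)%N))// leq_exp2r// -{1}(expn1 2) leq_exp2l.
have {}nxy : 2 / (2 ^+ m) ^+ n < y - x.
  by rewrite ltr_pdivrMr// mulrC -ltr_pdivrMr// subr_gt0.
pose t := Num.truncn (x * (2 ^+ m) ^+ n).
have /andP[tx xt] : t%:R <= x * (2 ^+ m) ^+ n < t.+1%:R.
  by apply: truncn_itv; rewrite mulr_ge0// ltW.
have ty : t.+2%:R / (2 ^+ m) ^+ n <= y.
  rewrite -(subrK x y) (le_trans _ (lerD (ltW nxy) (lexx x)))//.
  rewrite -addn2 natrD mulrDl addrC lerD2l.
  by rewrite ler_pdivrMr.
have tN : (t.+1 < (2 ^ m) ^ n)%N.
  by move: (le_trans ty y1); rewrite ler_pdivrMr// mul1r -NE ler_nat.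
rewrite (le_lt_trans _ (lt_le_trans (Phi_adic_lt tN) _))//; apply: Phi_homo => //.
by rewrite ler_pdivlMr// ltW.
Qed.

Lemma varphi_lt : (0 < m)%N -> {in `[0, 1] &, {homo varphi P : x y / x < y}}.
Proof.
move=> m0 x y x01 y01 xy; rewrite /varphi ltr_pM2l ?invr_gt0 ?ltr0n//.
rewrite (bigD1 (Ordinal m0))//= [ltRHS](bigD1 (Ordinal m0))//=.
(* The summand of level 0 is [Phi P x - Phi P 0], strictly increasing; the other levels are
   nondecreasing. *)
apply: ltr_leD.
  by rewrite !big_ord1 !addr0 !divr1 ltrD2r Phi_lt.
apply: ler_sum => i _; apply: ler_sum => k _; rewrite lerD2r.
by apply: Phi_homo => //; rewrite ler_pM2r ?invr_gt0 ?exprn_gt0// lerD2r ltW.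
Qed.

End strict_monotonicity.

(** * The perturbed uniform weights and their negative variance *)

Lemma sum_even_indicator h : (\sum_(k < h.*2) ~~ odd k = h)%N.
Proof.
elim: h => [|h IH]; first by rewrite big_ord0.
by rewrite doubleS !big_ord_recr/= IH odd_double/= addn0 addn1.
Qed.

Section perturbed_uniform_weights.
Context (R : realType) (n : nat).
Let m := n.+2.

(** The intended value of [Phi] at [k / 2 ^ m]. In units of [2 ^- m], the weights are 3/4, 5/4, 1, 1
    according to [k] modulo 4; as differences of this function, their partial sums telescope. *)
Definition perturbed_cdf (k : nat) : R :=
  (k%:R - (k %% 4 == 1)%N%:R / 4) / 2 ^+ m.

Definition perturbed_weights (k : 'I_(2 ^ m)) : R :=
  perturbed_cdf k.+1 - perturbed_cdf k.

Local Notation S := perturbed_cdf.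
Local Notation P := perturbed_weights.

Let N_gt0 : 0 < 2 ^+ m :> R. Proof. exact: exprn_gt0. Qed.

Let N_ge4 : 4 <= 2 ^+ m :> R.
Proof. by rewrite -natrX ler_nat /m !expnS mulnA leq_pmulr// expn_gt0. Qed.

Let S0 : S 0 = 0.
Proof. by rewrite /S/= mul0r subr0 mul0r. Qed.

Lemma perturbed_cdf_even k : ~~ odd k -> S k = k%:R / 2 ^+ m.
Proof.
move=> ek; rewrite /S (_ : (k %% 4 == 1)%N = false) ?mul0r ?subr0//.
apply: contraNF ek => /eqP k1; by rewrite (divn_eq k 4) k1 oddD oddM andbF.
Qed.

Lemma perturbed_weightsE k :
  P k = (1 - ((k.+1 %% 4 == 1)%N%:R - (k %% 4 == 1)%N%:R) / 4) / 2 ^+ m.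
Proof. by rewrite /P /S -natr1; field; rewrite gt_eqF. Qed.

Lemma perturbed_weights_gt0 k : 0 < P k.
Proof.
rewrite perturbed_weightsE divr_gt0//.
by case: eqP => _; case: eqP => _ /=; lra.
Qed.

Lemma perturbed_weights_sum k : (k <= 2 ^ m)%N ->
  \sum_(j < 2 ^ m | (j < k)%N) P j = S k.
Proof.
move=> kN; rewrite -(big_ord_widen _ (fun j => S j.+1 - S j) kN).
by rewrite -(big_mkord xpredT (fun j => S j.+1 - S j)) telescope_sumr// S0 subr0.
Qed.

Lemma perturbed_weightsP : weights R m P.
Proof.
split=> [k|].
  rewrite ltW ?perturbed_weights_gt0//= perturbed_weightsE ltr_pdivrMr// mul1r.
  by move: N_ge4; case: eqP => _; case: eqP => _ /=; lra.
rewrite -[RHS](_ : S (2 ^ m) = 1); last first.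
  by rewrite perturbed_cdf_even ?natrX ?divff ?gt_eqF// oddX.
rewrite -perturbed_weights_sum//; apply: eq_bigl => j.
by rewrite ltn_ord.
Qed.

Let Phi_branch (k : 'I_(2 ^ m)) x : 0 <= x <= 1 ->
  Phi P ((x + k%:R) / 2 ^+ m) = S k + P k * Phi P x.
Proof.
move=> x01; rewrite (Phi_ifs_map perturbed_weightsP)// perturbed_weights_sum//.
exact: ltnW.
Qed.

Let Phi_dyadic k : (k < 2 ^ m)%N -> Phi P (k%:R / 2 ^+ m) = S k.
Proof.
move=> kN; have := @Phi_branch (Ordinal kN) 0; rewrite lexx ler01 => /(_ erefl).
by rewrite /= add0r (Phi0 perturbed_weightsP) mulr0 addr0.
Qed.

(** Dyadic points of level below [m] have an even numerator over [2 ^ m], where the perturbation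
    vanishes. *)
Let Phi_even i k : (i <= n)%N -> (k < 2 ^ i.+1)%N ->
  Phi P (k%:R / 2 ^+ i.+1) = k%:R / 2 ^+ i.+1.
Proof.
move=> im ki.
have Em : m = (i.+1 + (n - i).+1)%N by rewrite addSn addnS subnKC.
have E : k%:R / 2 ^+ i.+1 = ((k * 2 ^ (n - i).+1)%N)%:R / 2 ^+ m :> R.
  rewrite natrM natrX Em exprD; field.
  by rewrite !expf_neq0// pnatr_eq0.
rewrite {1}E Phi_dyadic ?perturbed_cdf_even ?E//.
  by rewrite oddM oddX andbF.
by rewrite Em expnD ltn_pmul2r// expn_gt0.
Qed.

(** The contribution of level [i] to [m] times [varphi P (1 / 4) - varphi P (1 / 2)]; the terms at
    [k / 2 ^ i] cancel. For uniform weights it would be -1/4. *)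
Let gap i := \sum_(k < 2 ^ i)
  (Phi P ((1 / 4 + k%:R) / 2 ^+ i) - Phi P ((1 / 2 + k%:R) / 2 ^+ i)).

Let sum_const i (c : R) : \sum_(k < 2 ^ i) (c / 2 ^+ i) = c.
Proof.
by rewrite sumr_const card_ord -[LHS]mulr_natr natrX mulfVK.
Qed.

Let Phi_half_shift i k : (i <= n)%N -> (k < 2 ^ i)%N ->
  Phi P ((1 / 2 + k%:R) / 2 ^+ i) = (1 / 2 + k%:R) / 2 ^+ i.
Proof.
move=> im ki.
have -> : (1 / 2 + k%:R) / 2 ^+ i = (k.*2.+1)%:R / 2 ^+ i.+1 :> R.
  rewrite -(@natr1 _ k.*2) -muln2 natrM exprS; field.
  by rewrite expf_neq0// pnatr_eq0.
by rewrite Phi_even// expnS mul2n ltn_Sdouble.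
Qed.

Let gap_low i : (i < n)%N -> gap i = - (1 / 4).
Proof.
move=> im; rewrite -[RHS](sum_const i); apply: eq_bigr => k _.
rewrite Phi_half_shift ?(ltnW im)//.
have E : (1 / 4 + k%:R) / 2 ^+ i = (k * 4).+1%:R / 2 ^+ i.+2 :> R.
  rewrite -(@natr1 _ (k * 4)) natrM !exprS; field.
  by rewrite expf_neq0// pnatr_eq0.
rewrite E Phi_even//; last first.
  by move: (ltn_ord k); rewrite !expnS; lia.
rewrite -E; field.
by rewrite expf_neq0// pnatr_eq0.
Qed.

(** The quarter points are now [(4 k + 1) / 2 ^ m], exactly where the distribution function is
    lowered: [2 ^ n] times, by a quarter of [2 ^- m]. *)
Let gap_n : gap n = - (1 / 4) - 1 / 16.
Proof.
rewrite -[RHS](sum_const n); apply: eq_bigr => k _.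
rewrite Phi_half_shift//.
have E : (1 / 4 + k%:R) / 2 ^+ n = (k * 4).+1%:R / 2 ^+ m :> R.
  rewrite -(@natr1 _ (k * 4)) natrM /m !exprS; field.
  by rewrite expf_neq0// pnatr_eq0.
rewrite E Phi_dyadic//; last first.
  by move: (ltn_ord k); rewrite /m !expnS; lia.
rewrite /S -addn1 modnMDl/= /m !exprS natrD natrM; field.
by rewrite expf_neq0// pnatr_eq0.
Qed.

(** The quarter points are now midpoints of the branches [2 k], so each term is minus half the
    weight of [2 k]. For the [2 ^ n] even [k] this weight is short of uniform by a quarter, a gain
    of 1/8 of [2 ^- m] each. *)
Let gap_Sn : gap n.+1 = - (1 / 4) + 1 / 32.
Proof.
have N0 : (2 : R) ^+ n != 0 by rewrite expf_neq0// pnatr_eq0.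
have Phi_half : Phi P (1 / 2) = 1 / 2.
  by have := @Phi_even 0 1 isT isT; rewrite expr1.
transitivity (\sum_(k < 2 ^ n.+1) ((- (1 / 4) : R) / 2 ^+ n.+1 + (~~ odd k)%:R / 8 / 2 ^+ m)).
  apply: eq_bigr => k _.
  have k2 : (k.*2 < 2 ^ m)%N by move: (ltn_ord k); rewrite /m (expnS 2 n.+1); lia.
  have k21 : (k.*2.+1 < 2 ^ m)%N by move: (ltn_ord k); rewrite /m (expnS 2 n.+1); lia.
  have -> : (1 / 4 + k%:R) / 2 ^+ n.+1 = (1 / 2 + (k.*2)%:R) / 2 ^+ m :> R.
    by rewrite -muln2 natrM /m !exprS; field.
  have -> : (1 / 2 + k%:R) / 2 ^+ n.+1 = (k.*2.+1)%:R / 2 ^+ m :> R.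
    by rewrite -(@natr1 _ k.*2) -muln2 natrM /m !exprS; field.
  rewrite Phi_dyadic// (@Phi_branch (Ordinal k2)) ?Phi_half; last by lra.
  rewrite /P/= perturbed_cdf_even ?odd_double// /S.
  have -> : (k.*2.+1 %% 4 == 1)%N = ~~ odd k.
    by move: (nat_of_ord k) => l; lia.
  rewrite -(@natr1 _ k.*2) /m !exprS; field.
  by [].
rewrite big_split/= sum_const -!mulr_suml -natr_sum.
rewrite expnS mul2n sum_even_indicator natrX /m !exprS; field.
by [].
Qed.

Lemma varphi_perturbed_variance_lt0 :
  varphi P (1 / 4) - varphi P (1 / 2) + 1 / 4 < 0.
Proof.
have m0 : 0 < m%:R :> R by rewrite ltr0n.
suff -> : varphi P (1 / 4) - varphi P (1 / 2) + 1 / 4 = - (1 / 32) / m%:R.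
  by rewrite mulNr oppr_lt0 divr_gt0//; lra.
rewrite /varphi -mulrBr -sumrB.
have -> : \sum_(i < m) (\sum_(k < 2 ^ i)
      (Phi P ((1 / 4 + k%:R) / 2 ^+ i) - Phi P (k%:R / 2 ^+ i)) -
    \sum_(k < 2 ^ i)
      (Phi P ((1 / 2 + k%:R) / 2 ^+ i) - Phi P (k%:R / 2 ^+ i))) =
    \sum_(i < m) gap i.
  apply: eq_bigr => i _; rewrite -sumrB; apply: eq_bigr => k _; ring.
(* Averaged over the levels, the terms -1/4 cancel the added 1/4; what remains is -1/16 + 1/32,
   divided by [m]. *)
rewrite !big_ord_recr/= gap_n gap_Sn (eq_bigr (fun=> - (1 / 4))); last first.
  by move=> i _; exact: gap_low.
rewrite sumr_const card_ord -mulr_natr /m -!natr1; field.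
by rewrite !natr1 pnatr_eq0.
Qed.
End perturbed_uniform_weights.

Unset Implicit Arguments.
Set Strict Implicit.

Theorem theorem3p5 (R : realType) (m : nat) (hm : (2 <= m)%N) :
  exists phi : R -> R,
    [/\ MW R m phi,
        {in `[0, 1] &, {homo phi : x y / x < y}} &
        ~ exists mu : probability (measurableTypeR R) R,
            M01 R mu /\ {in `[0, 1], forall x, phi x = deRham_mixture mu x}].
Proof.
case: m hm => [|[|n]]// _.
have wP := @perturbed_weightsP R n.
exists (varphi (@perturbed_weights R n)); split.
- by exists (@perturbed_weights R n).
- exact: (varphi_lt wP (@perturbed_weights_gt0 R n)).
- move=> [mu [_ phiE]].
  (* The supposed identity at 1/4 and 1/2 would make this negative quantity the one of a mixture,
     which is nonnegative. *)
  have := @varphi_perturbed_variance_lt0 R n.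
  rewrite !phiE ?in_itv/= ?ltNge ?deRham_mixture_variance//.
    by apply/andP; split; lra.
  by apply/andP; split; lra.
Qed.
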